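(* Let $A\in H_\alpha$. Suppose that for some sequence $\beta_n\to\infty$ the Gibbs measures $\mu_{\beta_nA}$ converge weakly to a probability measure $\mu_\infty$. Then $\mu_\infty$ is a maximizing probability for $A$, i.e. $\mu_\infty\in\mathcal M_\sigma$ and $$\int_{\mathcal B}A\,d\mu_\infty=m(A).$$ If the maximizing probability for $A$ is unique, then there is selection of Gibbs probability at temperature zero, i.e. $\mu_{\beta A}$ converges weakly to a limit as $\beta\to\infty$ (not only along a subsequence).
   Context: $(M,d_M)$ is a compact metric space, $\mathcal B=M^{\mathbb N}$ (with $\mathbb N=\{1,2,\dots\}$) has the metric $d(x,y)=\sum_{n\ge1}2^{-n}d_M(x_n,y_n)$, $\sigma:\mathcal B\to\mathcal B$ is the shift, $\mathcal C$ is the space of continuous functions $\mathcal B\to\mathbb R$, and $\mathcal M_\sigma$ is the set of $\sigma$-invariant Borel probability measures on $\mathcal B$. Fix $\alpha\in(0,1]$; $H_\alpha$ is the set of $\alpha$-Hölder continuous functions $\mathcal B\to\mathbb R$. Fix a Borel probability measure $\nu$ on $M$ whose support is all of $M$. For $a\in M$, $x\in\mathcal B$, $ax=(a,x_1,x_2,\dots)$. For $A\in H_\alpha$, $\mathcal L_A(\varphi)(x)=\int_M e^{A(ax)}\varphi(ax)\,d\nu(a)$ on $\mathcal C$, and the dual operator on Borel measures is defined by $\int\varphi\,d\mathcal L_A^*(\mu)=\int\mathcal L_A(\varphi)\,d\mu$ for all $\varphi\in\mathcal C$. For $A\in H_\alpha$ there are $\lambda_A>0$ and a strictly positive $\psi_A\in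 H_\alpha$, unique up to a multiplicative constant, with $\mathcal L_A\psi_A=\lambda_A\psi_A$; set $\bar A=A+\log\psi_A-\log(\psi_A\circ\sigma)-\log\lambda_A$. The Gibbs measure $\mu_A$ of $A$ is the unique Borel probability measure with $\mathcal L_{\bar A}^*(\mu_A)=\mu_A$; it is $\sigma$-invariant. $\mu_{\beta A}$ denotes the Gibbs measure of the potential $\beta A$, $\beta>0$. $m(A)=\max_{\mu\in\mathcal M_\sigma}\int_{\mathcal B}A\,d\mu$, and a maximizing probability for $A$ is a $\mu\in\mathcal M_\sigma$ attaining this maximum. *)

(* Defs.v *)
From HB Require Import structures.
From mathcomp Require Import all_boot all_order all_algebra.
From mathcomp Require Import all_classical all_reals all_analysis.

Set Implicit Arguments.
Unset Strict Implicit.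
Unset Printing Implicit Defensive.

Import Order.TTheory GRing.Theory Num.Theory.
Import numFieldNormedType.Exports.

Local Open Scope classical_set_scope.
Local Open Scope ring_scope.

HB.mixin Record isCompactSpace M & Topological M := {
  compact_space : compact [set: M]
}.

(* The base point serves only to give [M] a canonical Borel measurable
   structure, since library measurable types are pointed. It loses no
   generality: an empty space carries no probability measure. *)
#[short(type="compactMetricType")]
HB.structure Definition CompactMetric (R : numDomainType) :=
  { M of Pointed M & Metric R M & isCompactSpace M }.

(* Indices are shifted: [x n] is the coordinate x_{n+1} of the sequence
   x = (x_1, x_2, ...). An alias, so as to carry the metric below and not the
   topologies that the library attaches to [nat -> M]. *)
Definition seqspace (R : realType) (M : compactMetricType R) : Type := nat -> M.

Section seqspace_metric.
Context {R : realType} (M : compactMetricType R).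
Implicit Types x y z : seqspace M.

HB.instance Definition _ := gen_eqMixin (seqspace M).
HB.instance Definition _ := gen_choiceMixin (seqspace M).
HB.instance Definition _ := isPointed.Build (seqspace M) (fun=> point).

Definition seqdist_term x y : R^nat :=
  fun n => (2 ^+ n.+1)^-1 * mdist (x n) (y n).

Definition seqdist x y : R := limn (series (seqdist_term x y)).

Lemma mdist_bounded : exists C : R, forall a b : M, mdist a b <= C.
Proof.
have cM : compact [set: M] := compact_space.
have [D _ HD] : finite_subset_cover [set: M] (fun p : M => (ball p 1)^°) setT.
  move: cM; rewrite compact_cover; apply.
    by move=> p _; exact: open_interior.
  by move=> p _; exists p => //; exact: nbhsx_ballx.
pose K : R := \sum_(p <- finmap.enum_fset D) mdist point p.
have HK p : p \in finmap.enum_fset D -> mdist point p <= K.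
  move=> pD; rewrite /K (big_rem p)//= lerDl.
  by apply: sumr_ge0 => i _; exact: mdist_ge0.
have H1 (b : M) : mdist point b <= K + 1.
  have [p /= pD] := HD b I.
  move=> /interior_subset; rewrite ballEmdist /= => pb.
  rewrite (le_trans (metric_triangle _ p _))// lerD//; last exact: ltW.
  exact: HK.
exists ((K + 1) + (K + 1)) => a b.
rewrite (le_trans (metric_triangle _ point _))// lerD// ?H1//.
by rewrite metric_sym.
Qed.

Lemma seqdist_term_ge0 x y n : 0 <= seqdist_term x y n.
Proof. by rewrite mulr_ge0// ?mdist_ge0// invr_ge0 exprn_ge0. Qed.

Lemma is_cvg_seqdist x y : cvgn (series (seqdist_term x y)).
Proof.
have [C HC] := mdist_bounded.
apply: (@series_le_cvg _ _ (geometric (C / 2) (2^-1))).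
- exact: seqdist_term_ge0.
- move=> n /=; rewrite mulr_ge0// ?exprn_ge0// divr_ge0//.
  exact: le_trans (mdist_ge0 _ _) (HC point point).
- move=> n /=; rewrite /seqdist_term mulrC exprS invfM mulrA exprVn.
  by rewrite ler_pM2r ?invr_gt0 ?exprn_gt0// ler_pM2r// HC.
- apply: is_cvg_geometric_series.
  by rewrite ger0_norm ?invr_ge0// invf_lt1// ltr1n.
Qed.

Lemma seqdistxx x : seqdist x x = 0.
Proof.
rewrite /seqdist (_ : series _ = cst 0) ?lim_cst//; apply/funext => n.
rewrite /series/= big1// => i _.
by rewrite /seqdist_term mdistxx mulr0.
Qed.

Lemma seqdist_positivity x y : seqdist x y = 0 -> x = y.
Proof.
move=> xy0; apply/funext => n; apply: mdist_positivity; apply/eqP.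
rewrite eq_le mdist_ge0 andbT.
have : seqdist_term x y n <= 0.
  rewrite -xy0 /seqdist.
  have nd : nondecreasing_seq (series (seqdist_term x y)).
    apply/nondecreasing_seqP => k; rewrite /series/= big_nat_recr//= lerDl.
    exact: seqdist_term_ge0.
  apply: (le_trans _ (nondecreasing_cvgn_le nd (@is_cvg_seqdist x y) n.+1)).
  rewrite /series/= big_nat_recr//= lerDr.
  by apply: sumr_ge0 => i _; exact: seqdist_term_ge0.
by rewrite pmulr_rle0// invr_gt0 exprn_gt0.
Qed.

Lemma seqdist_sym x y : seqdist x y = seqdist y x.
Proof.
rewrite /seqdist; congr (limn (series _)); apply/funext => n.
by rewrite /seqdist_term metric_sym.
Qed.

Lemma seqdist_triangle y x z : seqdist x z <= seqdist x y + seqdist y z.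
Proof.
have cxy := @is_cvg_seqdist x y; have cyz := @is_cvg_seqdist y z.
rewrite -limD//; apply: ler_lim; first exact: is_cvg_seqdist.
  exact: is_cvgD.
near=> n; rewrite [leRHS]/GRing.add /= /series/= -big_split/=.
by apply: ler_sum => i _; rewrite /seqdist_term -mulrDr ler_pM2l ?metric_triangle//.
Unshelve. all: by end_near. Qed.

HB.instance Definition _ := isMetric.Build R (seqspace M)
  seqdistxx seqdist_positivity seqdist_sym seqdist_triangle.

End seqspace_metric.

Notation borel T := (g_sigma_algebraType (@open T)).

Section gibbs.
Context {R : realType} {M : compactMetricType R}.
Implicit Types (alpha : R) (nu : probability (borel M) R).
Implicit Types (A phi psi : seqspace M -> R).
Implicit Types (mu : probability (borel (seqspace M)) R).

Definition shift (x : seqspace M) : seqspace M := fun n => x n.+1.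

Definition scons (a : M) (x : seqspace M) : seqspace M :=
  fun n => if n is k.+1 then x k else a.

Definition holder alpha phi : Prop :=
  exists C : R, forall x y, `|phi x - phi y| <= C * mdist x y `^ alpha.

Definition measure_support nu : set M :=
  [set a | forall U : set M, open U -> U a -> (0 < nu U)%E].

Definition transfer nu A phi (x : seqspace M) : R :=
  \int[nu]_a (expR (A (scons a x)) * phi (scons a x)).

(* mu' = L_A^* mu *)
Definition dual_transfer nu A mu mu' : Prop :=
  forall phi, continuous phi ->
    \int[mu']_x phi x = \int[mu]_x transfer nu A phi x.

Definition eigenpair alpha nu A (lambda : R) psi : Prop :=
  [/\ 0 < lambda, holder alpha psi, (forall x, 0 < psi x) &
      forall x, transfer nu A psi x = lambda * psi x].

Definition normalization A (lambda : R) psi : seqspace M -> R :=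
  fun x => A x + ln (psi x) - ln (psi (shift x)) - ln lambda.

(* As psi is unique up to a multiplicative constant, which cancels in the
   normalization, this does not depend on the choice of (lambda, psi). The
   uniqueness of the fixed point mu is a theorem, not a requirement here. *)
Definition gibbs alpha nu A mu : Prop :=
  exists lambda psi, eigenpair alpha nu A lambda psi /\
    dual_transfer nu (normalization A lambda psi) mu mu.

Definition shift_invariant mu : Prop :=
  forall X : set (borel (seqspace M)), measurable X -> mu (shift @^-1` X) = mu X.

(* The supremum is a maximum exactly when it is attained, which is what
   [maximizing] asserts. *)
Definition max_value A : R :=
  sup [set \int[mu]_x A x | mu in [set mu | shift_invariant mu]].

Definition maximizing A mu : Prop :=
  shift_invariant mu /\ \int[mu]_x A x = max_value A.

(* Measures are compared on Borel sets only: the library leaves their values on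
   non-measurable sets unspecified, so Leibniz equality would be too strong. *)
Definition unique_maximizing A : Prop :=
  exists mu, maximizing A mu /\
    forall mu', maximizing A mu' ->
      forall X : set (borel (seqspace M)), measurable X -> mu' X = mu X.

Definition weak_cvg {I : Type} (F : set_system I)
    (mu_ : I -> probability (borel (seqspace M)) R) mu : Prop :=
  forall phi, continuous phi ->
    \int[mu_ i]_x phi x @[i --> F] --> \int[mu]_x phi x.

End gibbs.

(* Main.v *)
Require Import Defs.
From HB Require Import structures.
From mathcomp Require Import all_boot all_order all_algebra.
From mathcomp Require Import all_classical all_reals all_analysis.
From mathcomp Require Import measurable_realfun ring lra.
Import Order.TTheory GRing.Theory Num.Theory.
Import numFieldNormedType.Exports.
Local Open Scope classical_set_scope.
Local Open Scope ring_scope.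

(** Let [psi] be the positive eigenfunction, with eigenvalue [lambda], of the
    transfer operator of the potential [beta * A], and let
    [g = beta * A + ln psi - ln (psi o shift) - ln lambda] be the normalized
    potential, so that [exp (g (a x)) d nu(a)] is a probability measure for
    every [x].  The two logarithms of [psi] cancel against any invariant
    measure [rho], whence [int g d rho = beta * int A d rho - ln lambda].  Two
    bounds on such integrals of [g], both independent of the unknown [lambda],
    give the result.

    - For the Gibbs measure [mu], [int g d mu >= 0]: the inequality
      [t * exp t >= exp t - 1] makes the transfer operator of [g] send [g] to a
      nonnegative function, and [mu] is fixed by its dual
      ([integral_normalization_ge0]).  This is the nonpositivity of entropy
      relative to [nu].

    - For every [x], [g x <= K * beta * r ^ alpha - ln c], where [c > 0] bounds
      from below the [nu]-mass of the balls of radius [r] and [K] does not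
      depend on [beta] ([normalization_le]).  Indeed [a |-> g (a x)] varies by
      at most [K * beta * r ^ alpha] over such a ball, and the integral of
      [exp g] over it is at most 1.  The point is that [ln psi] has a Hoelder
      constant proportional to [beta] ([eigen_ln_holder]): prefixing a letter
      contracts distances by a factor 2, so the eigenfunction equation improves
      any Hoelder constant of [ln psi] towards a fixed point.

    Subtracting, [int A d rho <= int A d mu + K * r ^ alpha - ln c / beta] for
    all invariant [rho]; choosing [r] small and then [beta] large, the Gibbs
    measures are almost maximizing ([gibbs_almost_maximizing]).  Both this and
    the invariance pass to weak limits ([weak_limit_maximizing]).

    For the second assertion, convergence is tested along ultrafilters finer
    than [beta --> +oo].  Along such an ultrafilter all integrals of continuous
    functions converge, to a positive normalized linear functional; the Riesz
    representation theorem turns it into a probability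
    ([probability_weak_ultralimit]), which is maximizing by the first part,
    hence equal to the unique maximizing probability.

    The Riesz theorem on a compact metric space ([riesz_representation]) comes
    from Caratheodory's construction.  The outer measure of [E] is the infimum
    of the costs of covering [E] by a nondecreasing sequence of nonnegative
    continuous functions that reaches 1 at each point of [E]; covering by
    increasing sequences, rather than by single functions or by open sets,
    makes countable subadditivity a computation with finite sums. *)

Set Implicit Arguments.
Unset Strict Implicit.
Unset Printing Implicit Defensive.

(** * Continuous functions and Borel measures on compact metric spaces *)

Section real_continuous.
Context {R : realType} {T : topologicalType}.
Implicit Types f g : T -> R.

Lemma fun_continuousD f g : continuous f -> continuous g ->
  continuous (fun x => f x + g x).
Proof. by move=> cf cg x; apply: cvgD; [exact: cf|exact: cg]. Qed.

Lemma fun_continuousB f g : continuous f -> continuous g ->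
  continuous (fun x => f x - g x).
Proof. by move=> cf cg x; apply: cvgB; [exact: cf|exact: cg]. Qed.

Lemma fun_continuousM f g : continuous f -> continuous g ->
  continuous (fun x => f x * g x).
Proof. by move=> cf cg x; apply: cvgM; [exact: cf|exact: cg]. Qed.

Lemma fun_continuousZ (c : R) f : continuous f -> continuous (fun x => c * f x).
Proof. by move=> cf; apply: fun_continuousM => //; exact: cst_continuous. Qed.

Lemma fun_continuous_min f (c : R) : continuous f ->
  continuous (fun x => Num.min c (f x)).
Proof.
move=> cf x; apply: (@continuous_min _ _ (cst c) f); last exact: cf.
exact: cst_continuous.
Qed.

Lemma fun_continuous_sum (F : nat -> T -> R) n : (forall i, continuous (F i)) ->
  continuous (fun x => \sum_(i < n) F i x).
Proof.
move=> cF; elim: n => [|n IHn].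
  by under eq_fun do rewrite big_ord0; exact: cst_continuous.
by under eq_fun do rewrite big_ord_recr/=; exact: fun_continuousD.
Qed.

End real_continuous.

Lemma lipschitz_continuous {R : realType} {T U : metricType R} (k : R) (f : T -> U) :
  0 < k -> (forall x y, mdist (f x) (f y) <= k * mdist x y) -> continuous f.
Proof.
move=> k0 Hf x B /(metricType_numDomainType.nbhs_mdistP)[e /= e0 HB].
apply/(metricType_numDomainType.nbhs_mdistP).
exists (e / k) => /=; first by rewrite divr_gt0.
move=> y xy; apply: HB => /=; rewrite (le_lt_trans (Hf _ _))//.
by rewrite mulrC -ltr_pdivlMr.
Qed.

Section compact_metric.
Context {R : realType} {T : compactMetricType R}.
Implicit Types (f g : T -> R) (mu : probability (borel T) R).

Lemma continuous_of_modulus f :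
  (forall x e, 0 < e -> exists2 d, 0 < d &
     forall y, mdist x y < d -> `|f x - f y| < e) ->
  continuous f.
Proof.
move=> H x; apply/cvgrPdist_lt => e /(H x)[d d0 Hd].
rewrite near_simpl; apply/(metricType_numDomainType.nbhs_mdistP).
by exists d.
Qed.

Lemma continuous_modulus f : continuous f ->
  forall x e, 0 < e -> exists2 d, 0 < d &
    forall y, mdist x y < d -> `|f x - f y| < e.
Proof.
move=> cf x e e0; have /cvgrPdist_lt/(_ _ e0) := cf x.
by rewrite near_simpl => /(metricType_numDomainType.nbhs_mdistP)[d d0 Hd]; exists d.
Qed.

Lemma continuous_bounded f : continuous f -> exists C, forall x, `|f x| <= C.
Proof.
move=> cf.
have /compact_bounded[C [_ HC]] : compact (f @` [set: T]).
  apply: continuous_compact; last exact: compact_space.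
  exact: continuous_subspaceT.
exists (C + 1) => x; apply: HC; first by rewrite ltrDl.
by exists x.
Qed.

Lemma continuous_gt0_bounded_below f : continuous f -> (forall x, 0 < f x) ->
  exists2 c, 0 < c & forall x, c <= f x.
Proof.
move=> cf f0; have [|C HC] := @continuous_bounded (fun x => (f x)^-1).
  by move=> x; apply: continuousV; [rewrite gt_eqF|exact: cf].
have C0 : 0 < C by apply: lt_le_trans (HC point); rewrite normr_gt0 invr_neq0// gt_eqF.
exists C^-1; first by rewrite invr_gt0.
move=> x; rewrite -[leRHS]invrK lef_pV2 ?posrE ?invr_gt0//.
exact: le_trans (ler_norm _) (HC x).
Qed.

Lemma open_borel (U : set T) : open U -> measurable (U : set (borel T)).
Proof. by move=> oU; exact: sub_sigma_algebra. Qed.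

Lemma continuous_borel f : continuous f ->
  measurable_fun [set: borel T] (f : borel T -> R).
Proof.
move=> /continuousP cf; apply: (measurability _ (RGenOpens.measurableE R)).
move=> _ [_ [a [b ->] <-]]; rewrite setTI; apply: open_borel.
exact/cf/interval_open.
Qed.

Lemma continuous_integrable mu f : continuous f ->
  mu.-integrable [set: borel T] (EFin \o f).
Proof.
move=> cf; apply: measurable_bounded_integrable => //.
- by rewrite [X in (X < _)%E](_ : _ = 1%E) ?ltry//; exact: probability_setT.
- exact: continuous_borel.
- have [C HC] := continuous_bounded cf; exists C; split; first exact: num_real.
  by move=> r Cr x _; exact: le_trans (HC x) (ltW Cr).
Qed.

Lemma le_integral_continuous mu f g : continuous f -> continuous g ->
  (forall x, f x <= g x) -> \int[mu]_x f x <= \int[mu]_x g x.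
Proof. by move=> cf cg fg; apply: le_Rintegral => //; exact: continuous_integrable. Qed.

Lemma integralD_continuous mu f g : continuous f -> continuous g ->
  \int[mu]_x (f x + g x) = \int[mu]_x f x + \int[mu]_x g x.
Proof. by move=> cf cg; apply: RintegralD => //; exact: continuous_integrable. Qed.

Lemma integralB_continuous mu f g : continuous f -> continuous g ->
  \int[mu]_x (f x - g x) = \int[mu]_x f x - \int[mu]_x g x.
Proof. by move=> cf cg; apply: RintegralB => //; exact: continuous_integrable. Qed.

Lemma integralZ_continuous mu (c : R) f : continuous f ->
  \int[mu]_x (c * f x) = c * \int[mu]_x f x.
Proof. by move=> cf; apply: RintegralZl => //; exact: continuous_integrable. Qed.

Lemma integral_cst_probability mu (c : R) : \int[mu]_x c = c.
Proof.
rewrite Rintegral_cst// [X in fine X](_ : _ = 1%E) ?mulr1//.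
exact: probability_setT.
Qed.

Lemma indicZ_integrable mu (K : set (borel T)) (c : R) : measurable K ->
  mu.-integrable [set: borel T] (EFin \o (fun x => c * \1_K x)).
Proof.
move=> mK; apply: measurable_bounded_integrable => //.
- by rewrite [X in (X < _)%E](_ : _ = 1%E) ?ltry//; exact: probability_setT.
- by apply: measurable_funM => //; exact: measurable_indic.
- exists `|c|; split; first exact: num_real.
  move=> r cr x _ /=; apply: le_trans (ltW cr).
  by rewrite normrM ler_piMr// indicE; case: (x \in K); rewrite ?normr1 ?normr0.
Qed.

Lemma integral_indicZ mu (K : set (borel T)) (c : R) : measurable K -> 0 <= c ->
  \int[mu]_x (c * \1_K x) = c * fine (mu K).
Proof.
move=> mK c0; rewrite /Rintegral (integralZl_indic measurableT (fun=> K))//.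
  rewrite integral_indic// setIT fineM//.
  by apply: fin_num_measure.
by rewrite ltNge c0.
Qed.

Lemma markov_continuous mu (K : set (borel T)) (c : R) f : measurable K ->
  0 <= c -> continuous f -> (forall x, 0 <= f x) -> (forall x, K x -> c <= f x) ->
  c * fine (mu K) <= \int[mu]_x f x.
Proof.
move=> mK c0 cf f0 Kf; rewrite -integral_indicZ//; apply: le_Rintegral => //.
- exact: indicZ_integrable.
- exact: continuous_integrable.
- move=> x _; have [Kx|Kx] := pselect (K x).
    by rewrite indicE mem_set// mulr1; exact: Kf.
  by rewrite indicE memNset// mulr0.
Qed.

Section bump.
Context (U : set T).

Let dists (x : T) : set R := [set r | r = 1 \/ exists2 z, ~ U z & r = mdist x z].

(** The distance to the complement of [U], truncated at 1. The truncation keeps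
    the infimum meaningful when [U] is the whole space. *)
Definition bump (x : T) : R := inf (dists x).

Let dists_inf x : has_inf (dists x).
Proof.
split; first by exists 1; left.
by exists 0 => r [->//|[z _ ->]]; exact: mdist_ge0.
Qed.

Lemma bump_ge0 x : 0 <= bump x.
Proof.
apply: lb_le_inf; first by exists 1; left.
by move=> r [->//|[z _ ->]]; exact: mdist_ge0.
Qed.

Lemma bump_le1 x : bump x <= 1.
Proof. by apply: ge_inf; [have [] := dists_inf x|left]. Qed.

Lemma bump_out x : ~ U x -> bump x = 0.
Proof.
move=> Ux; apply/eqP; rewrite eq_le bump_ge0 andbT.
by apply: ge_inf; [have [] := dists_inf x|right; exists x; rewrite ?mdistxx].
Qed.

Lemma bump_lipschitz x y : bump x <= bump y + mdist x y.
Proof.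
rewrite -lerBlDr; apply: lb_le_inf; first by exists 1; left.
move=> r [->|[z Uz ->]]; rewrite lerBlDr.
  by rewrite (le_trans (bump_le1 _))// lerDl mdist_ge0.
rewrite addrC (le_trans _ (metric_triangle _ _ _))//.
by apply: ge_inf; [have [] := dists_inf x|right; exists z].
Qed.

Lemma bump_continuous : continuous bump.
Proof.
apply: continuous_of_modulus => x e e0; exists e => // y xy.
rewrite ltr_norml -[mdist x y]opprK in xy *; apply/andP; split.
  have := bump_lipschitz y x; rewrite metric_sym; lra.
have := bump_lipschitz x y; lra.
Qed.

Lemma bump_in x : open U -> U x -> 0 < bump x.
Proof.
move=> oU Ux; have /(metricType_numDomainType.nbhs_mdistP) [d /= d0 Hd] : nbhs x U.
  exact: open_nbhs_nbhs.
apply: (@lt_le_trans _ _ (Num.min 1 d)); first by rewrite lt_min ltr01.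
apply: lb_le_inf; first by exists 1; left.
move=> r [->|[z Uz ->]]; rewrite ge_min ?lexx//.
by apply/orP; right; rewrite leNgt; apply/negP => /Hd.
Qed.

(** For [U] open these increase with [k] to the indicator of [U], and reach it
    after finitely many steps at each point. *)
Definition step_bump (k : nat) (x : T) : R := Num.min 1 (k%:R * bump x).

Lemma step_bump_continuous k : continuous (step_bump k).
Proof. by apply/fun_continuous_min/fun_continuousZ/bump_continuous. Qed.

Lemma step_bump_ge0 k x : 0 <= step_bump k x.
Proof. by rewrite le_min ler01 mulr_ge0// bump_ge0. Qed.

Lemma step_bump_le1 k x : step_bump k x <= 1.
Proof. by rewrite ge_min lexx. Qed.

Lemma step_bump_out k x : ~ U x -> step_bump k x = 0.
Proof. by move=> Ux; rewrite /step_bump bump_out// mulr0 min_r. Qed.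

Lemma step_bump_homo j k x : (j <= k)%N -> step_bump j x <= step_bump k x.
Proof.
move=> jk; rewrite /step_bump le_min ge_min lexx/= ge_min; apply/orP; right.
by rewrite ler_wpM2r ?bump_ge0// ler_nat.
Qed.

Lemma step_bump_in x : open U -> U x ->
  exists k, forall j, (k <= j)%N -> step_bump j x = 1.
Proof.
move=> oU Ux; have b0 := bump_in oU Ux.
exists (Num.truncn (bump x)^-1).+1 => j kj; rewrite /step_bump min_l//.
rewrite -ler_pdivrMr// mul1r; apply: (@le_trans _ _ (Num.truncn (bump x)^-1).+1%:R).
  exact/ltW/truncnS_gt.
by rewrite ler_nat.
Qed.

End bump.

Lemma step_bump_cvg (U : set T) x : open U ->
  step_bump U k x @[k --> \oo] --> (\1_U x : R).
Proof.
move=> oU; have [Ux|nUx] := pselect (U x).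
  have [k Hk] := step_bump_in oU Ux.
  rewrite indicE mem_set//; apply: cvg_near_cst.
  by exists k => // j /= kj; rewrite Hk.
rewrite indicE memNset//; apply: cvg_near_cst; apply: nearW => k.
by rewrite step_bump_out.
Qed.

Lemma integral_step_bump_cvg mu (U : set T) : open U ->
  \int[mu]_x step_bump U k x @[k --> \oo] --> fine (mu U).
Proof.
move=> oU.
have mU := open_borel oU.
have [] := @dominated_convergence _ (borel T) R mu setT measurableT
   (fun k x => (step_bump U k x)%:E) (fun x => (\1_U x)%:E) (cst 1%E).
- move=> k; apply/measurable_EFinP; apply: continuous_borel; exact: step_bump_continuous.
- by apply/measurable_EFinP; exact: measurable_indic.
- apply: aeW => x _; apply: cvg_EFin; first exact: nearW.
  exact: step_bump_cvg.
- exact: (@continuous_integrable mu (cst 1) (@cst_continuous _ _ _)).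
- apply: aeW => x k _; rewrite lee_fin ger0_norm ?step_bump_ge0//.
  exact: step_bump_le1.
move=> _ _; rewrite integral_indic// setIT => H.
by apply: fine_cvg; rewrite fineK// fin_num_measure.
Qed.

(** Integrals of [step_bump] recover the mass of open sets, which form a
    generating family stable under intersection. *)
Lemma eq_borel_of_continuous mu1 mu2 :
  (forall f, continuous f -> \int[mu1]_x f x = \int[mu2]_x f x) ->
  forall X : set (borel T), measurable X -> mu1 X = mu2 X.
Proof.
move=> H X mX.
apply: (@measure_unique _ R (borel T) (@open T) (fun=> setT) _ _ _ _ mu1 mu2) => //.
- by move=> A B; exact: openI.
- by move=> _; exact: openT.
- by apply/seteqP; split => // x _; exists 0%N.
- move=> U oU; rewrite -[LHS]fineK ?fin_num_measure//; last exact: open_borel.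
  rewrite -[RHS]fineK ?fin_num_measure//; last exact: open_borel.
  congr EFin; have /cvg_lim <- // := integral_step_bump_cvg (mu := mu2) oU.
  have /cvg_lim <- // := integral_step_bump_cvg (mu := mu1) oU.
  congr (limn _); apply/funext => k; apply: H.
  exact: step_bump_continuous.
- by move=> _; rewrite [X in (X < _)%E](_ : _ = 1%E) ?ltry//; exact: probability_setT.
Qed.

End compact_metric.

(** * The Riesz representation theorem on a compact metric space *)

(** A predicate on functionals of arbitrary functions, so that continuous
    functions need no type of their own: only their images are constrained. *)
Record mean {R : realType} {T : topologicalType} (L : (T -> R) -> R) : Prop := {
  meanD : forall f g : T -> R, continuous f -> continuous g ->
    L (fun x => f x + g x) = L f + L g ;
  meanZ : forall (c : R) (f : T -> R), continuous f -> L (fun x => c * f x) = c * L f ;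
  mean_ge0 : forall f : T -> R, continuous f -> (forall x, 0 <= f x) -> 0 <= L f ;
  mean1 : L (fun=> 1) = 1 }.

Section riesz.
Context {R : realType} {T : compactMetricType R}.
Context (L : (T -> R) -> R) (meanL : mean L).
Implicit Types (f g : T -> R) (E : set T).

Let meanB f g : continuous f -> continuous g ->
  L (fun x => f x - g x) = L f - L g.
Proof.
move=> cf cg; rewrite -[RHS]/(L f + - L g) -mulN1r -(meanZ meanL)// -(meanD meanL)//.
  by congr L; apply/funext => x; rewrite mulN1r.
exact: fun_continuousZ.
Qed.

Let le_mean f g : continuous f -> continuous g -> (forall x, f x <= g x) ->
  L f <= L g.
Proof.
move=> cf cg fg; rewrite -subr_ge0 -meanB//; apply: (mean_ge0 meanL).
  exact: fun_continuousB.
by move=> x; rewrite subr_ge0.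
Qed.

Let mean0 : L (fun=> 0) = 0.
Proof.
rewrite -[RHS](mul0r (L (fun=> 1))) -(meanZ meanL).
  by congr L; apply/funext => x; rewrite mul0r.
exact: cst_continuous.
Qed.

Let mean_cst c : L (fun=> c) = c.
Proof.
rewrite -[RHS]mulr1 -(mean1 meanL) -(meanZ meanL).
  by congr L; apply/funext => x; rewrite mulr1.
exact: cst_continuous.
Qed.

Let mean_sum (F : nat -> T -> R) n : (forall i, continuous (F i)) ->
  L (fun x => \sum_(i < n) F i x) = \sum_(i < n) L (F i).
Proof.
move=> cF; elim: n => [|n IHn].
  by rewrite big_ord0 -[RHS]mean0; congr L; apply/funext => x; rewrite big_ord0.
rewrite big_ord_recr/= -IHn -(meanD meanL)//.
  by congr L; apply/funext => x; rewrite big_ord_recr.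
exact: fun_continuous_sum.
Qed.

(** The value 1 has to be reached at a finite stage, not only in the limit: then
    products of covers with [step_bump] are again covers. *)
Definition covered_at_cost E (c : R) := exists h : nat -> T -> R,
  [/\ forall k, continuous (h k), forall k x, 0 <= h k x,
      forall x j k, (j <= k)%N -> h j x <= h k x,
      forall k, L (h k) <= c &
      forall x, E x -> exists k, 1 <= h k x].

Lemma covered_at_cost_ge0 E c : covered_at_cost E c -> 0 <= c.
Proof.
move=> [h [ch h0 _ /(_ 0%N) hc _]]; apply: le_trans hc.
exact: (mean_ge0 meanL).
Qed.

Lemma covered_at_cost1 E : covered_at_cost E 1.
Proof.
exists (fun _ _ => 1); split=> //.
- by move=> _; exact: cst_continuous.
- by move=> _; rewrite mean1.
- by move=> x _; exists 0%N.
Qed.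

Definition outer E : R := inf [set c | covered_at_cost E c].

Let cost_inf E : has_inf [set c | covered_at_cost E c].
Proof.
split; first by exists 1; exact: covered_at_cost1.
by exists 0 => c; exact: covered_at_cost_ge0.
Qed.

Lemma outer_le E c : covered_at_cost E c -> outer E <= c.
Proof. by move=> Ec; apply: ge_inf => //; have [] := cost_inf E. Qed.

Lemma le_outer E c : (forall d, covered_at_cost E d -> c <= d) -> c <= outer E.
Proof. by move=> H; apply: lb_le_inf => //; have [] := cost_inf E. Qed.

Definition riesz_outer E : \bar R := (outer E)%:E.

Let outer0 : riesz_outer set0 = 0%E.
Proof.
congr EFin; apply/eqP; rewrite eq_le; apply/andP; split.
  apply: outer_le; exists (fun _ _ => 0); split=> //.
    by move=> _; exact: cst_continuous.
  by move=> _; rewrite mean0.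
by apply: le_outer => d; exact: covered_at_cost_ge0.
Qed.

Let outer_ge0 E : (0 <= riesz_outer E)%E.
Proof. by rewrite lee_fin; apply: le_outer => d; exact: covered_at_cost_ge0. Qed.

Let outer_homo : {homo riesz_outer : A B / A `<=` B >-> (A <= B)%E}.
Proof.
move=> A B AB; rewrite lee_fin; apply: le_outer => d [h [ch h0 hh hd hB]].
by apply: outer_le; exists h; split=> // x /AB; exact: hB.
Qed.

Let sum_half (e : R) n : \sum_(i < n) e / 2 ^+ i.+1 = e - e / 2 ^+ n.
Proof.
elim: n => [|n IHn]; first by rewrite big_ord0 expr0 divr1 subrr.
rewrite big_ord_recr/= IHn exprS invfM.
set y := (2 ^+ n)^-1; have : (2 : R) != 0 by [].
by move=> ?; field.
Qed.

(** Given almost optimal covers [h n] of the sets [F n], the diagonal sums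
    [\sum_(n < k) h n k] form one nondecreasing sequence covering the union,
    since a point of [F n] only needs the [n]-th summand. *)
Let outer_sigma_subadditive : sigma_subadditive riesz_outer.
Proof.
move=> F; set S := (\sum_(i <oo) _)%E.
have S0 : (0 <= S)%E by exact: nneseries_ge0.
have partial n : ((\sum_(i < n) outer (F i))%:E <= S)%E.
  have := @nneseries_lim_ge R (fun i => riesz_outer (F i)) xpredT 0%N n
    (fun n _ _ => outer_ge0 (F n)).
  by move=> H; rewrite -sumEFin -(big_mkord xpredT (fun i => riesz_outer (F i))).
move: S S0 partial => [s||]// _ partial; last by rewrite leey.
rewrite lee_fin; apply/ler_addgt0Pr => e e0.
have : forall n, exists hn : nat -> T -> R,
    [/\ forall k, continuous (hn k), forall k x, 0 <= hn k x,
      forall x j k, (j <= k)%N -> hn j x <= hn k x,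
      forall k, L (hn k) <= outer (F n) + e / 2 ^+ n.+1 &
      forall x, F n x -> exists k, 1 <= hn k x].
  move=> n; have en0 : 0 < e / 2 ^+ n.+1 by rewrite divr_gt0// exprn_gt0.
  have [c [h [ch h0 hh hc hF]] cn] := inf_adherent en0 (cost_inf (F n)).
  by exists h; split=> // k; exact: le_trans (hc k) (ltW cn).
move=> /choice[h Hh].
apply: outer_le; exists (fun k x => \sum_(n < k) h n k x); split.
- by move=> k; apply: (@fun_continuous_sum _ _ (fun i => h i k)) => i; have [] := Hh i.
- by move=> k x; apply: sumr_ge0 => i _; have [] := Hh i.
- move=> x j k jk; rewrite -!(big_mkord xpredT (fun i => h i _ x)).
  rewrite (big_cat_nat (leq0n j) jk)/= -[leLHS]addr0 lerD//.
    by apply: ler_sum => i _; have [_ _ + _ _] := Hh i; exact.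
  by apply: sumr_ge0 => i _; have [] := Hh i.
- move=> k; rewrite (@mean_sum (fun i => h i k)); last by move=> i; have [] := Hh i.
  apply: (@le_trans _ _ (\sum_(i < k) (outer (F i) + e / 2 ^+ i.+1))).
    by apply: ler_sum => i _; have [] := Hh i.
  rewrite big_split/= sum_half lerD//; first by have := partial k; rewrite lee_fin.
  by rewrite lerBlDr lerDl divr_ge0// ?exprn_ge0// ltW.
- move=> x [n _ Fx]; have [_ h0 hh _ /(_ _ Fx)[k kx]] := Hh n.
  exists (maxn k n.+1); have nk : (n < maxn k n.+1)%N by rewrite leq_max leqnn orbT.
  rewrite (bigD1 (Ordinal nk))//= (le_trans kx)// (@le_trans _ _ (h n (maxn k n.+1) x))//.
    by apply: hh; rewrite leq_maxl.
  by rewrite lerDl; apply: sumr_ge0 => i _; have [] := Hh i.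
Qed.

HB.instance Definition _ := isOuterMeasure.Build R T riesz_outer
  outer0 outer_ge0 outer_homo outer_sigma_subadditive.

(** A cover [h] of [X] splits along the functions [u k = step_bump U k]:
    [h k * u k] covers the part of [X] in [U], and [h k * (1 - u j)], for any
    fixed [j], the part outside [U]. The costs add up to that of [h] once [j] is
    so large that [L (h j * u j)] nearly attains its supremum. *)
Lemma open_caratheodory (U : set T) : open U -> riesz_outer.-caratheodory U.
Proof.
move=> oU; apply: le_caratheodory_measurable => X.
rewrite lee_fin; apply: le_outer => c [h [ch h0 hh hc hX]].
pose hg k x := h k x * step_bump U k x.
have chg k : continuous (hg k).
  by apply: fun_continuousM => //; exact: step_bump_continuous.
have hgh x j k : (j <= k)%N -> hg j x <= hg k x.
  by move=> jk; apply: ler_pM; rewrite ?h0 ?step_bump_ge0 ?hh ?step_bump_homo.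
pose D := [set L (hg k) | k in setT].
have supD : has_sup D.
  split; first by exists (L (hg 0%N)), 0%N.
  exists c => _ [k _ <-]; apply: le_trans (hc k); apply: le_mean => // x.
  by rewrite ler_piMr ?h0 ?step_bump_le1.
apply/ler_addgt0Pr => e e0.
have [_ [j _ <-] je] := sup_adherent e0 supD.
have -> : c + e = sup D + (c - (sup D - e)) by ring.
apply: lerD; apply: outer_le.
- exists hg; split=> //.
  + by move=> k x; rewrite mulr_ge0 ?h0 ?step_bump_ge0.
  + by move=> k; apply: ub_le_sup; [case: supD|exists k].
  + move=> x [Xx Ux]; have [k kx] := hX _ Xx; have [l lx] := step_bump_in oU Ux.
    exists (maxn k l); rewrite /hg lx ?leq_maxr// mulr1.
    by rewrite (le_trans kx)// hh// leq_maxl.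
- have chB k : continuous (fun x => h k x - h k x * step_bump U j x).
    apply: fun_continuousB => //.
    by apply: fun_continuousM => //; exact: step_bump_continuous.
  have fact (a b : R) : a - a * b = a * (1 - b) by ring.
  exists (fun k x => h k x - h k x * step_bump U j x); split.
  + exact: chB.
  + by move=> k x; rewrite subr_ge0 ler_piMr ?h0 ?step_bump_le1.
  + by move=> x i k ik; rewrite !fact ler_wpM2r ?hh// subr_ge0 step_bump_le1.
  + have late k : (j <= k)%N ->
        L (fun x => h k x - h k x * step_bump U j x) <= c - (sup D - e).
      move=> jk; rewrite meanB//; last first.
        by apply: fun_continuousM => //; exact: step_bump_continuous.
      apply: lerB; first exact: hc.
      rewrite (le_trans (ltW je))//; apply: le_mean => //.
        by apply: fun_continuousM => //; exact: step_bump_continuous.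
      by move=> x; rewrite ler_wpM2r ?step_bump_ge0 ?hh.
    move=> k; apply: le_trans (late (maxn k j) (leq_maxr _ _)); apply: le_mean.
    * exact: chB.
    * exact: chB.
    * by move=> x; rewrite !fact ler_wpM2r ?hh ?leq_maxl// subr_ge0 step_bump_le1.
  + move=> x [Xx Ux]; have [k kx] := hX _ Xx; exists k.
    by rewrite step_bump_out// mulr0 subr0.
Qed.

Lemma borel_caratheodory (X : set (borel T)) : measurable X ->
  riesz_outer.-cara.-measurable X.
Proof.
move: X; apply: smallest_sub; last exact: open_caratheodory.
split.
- exact: measurable0.
- by move=> X mX; rewrite setTD; exact: measurableC.
- by move=> F mF; exact: bigcupT_measurable.
Qed.

(** This is where compactness enters (Dini): a nondecreasing sequence of
    continuous functions that reaches 1 at every point is eventually uniformly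
    above [1 - e]. *)
Lemma outer_setT : outer setT = 1.
Proof.
apply/eqP; rewrite eq_le outer_le/=; last exact: covered_at_cost1.
apply: le_outer => c [h [ch h0 hh hc hT]]; apply/ler_addgt0Pr => e e0.
have : \forall k \near \oo, [set: T] `<=` [set x | 1 - e <= h k x].
  have /compact_near_coveringP := @compact_space _ T; apply=> x _.
  have [k kx] := hT x I; have [d d0 Hd] := continuous_modulus (ch k) x e0.
  exists (ball x d, [set l | (k <= l)%N]) => /=.
    by split; [exact: nbhsx_ballx|exists k].
  move=> [y l]/= [+ kl]; rewrite ballEmdist/= => /Hd.
  rewrite ltr_norml => /andP[_ xy]; apply: le_trans (hh y _ _ kl); lra.
move=> [k _ /(_ k (leqnn k)) Hk].
rewrite -lerBlDr (le_trans _ (hc k))// -(mean_cst (1 - e)).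
by apply: le_mean => //; [exact: cst_continuous|move=> x; exact: Hk].
Qed.

Definition riesz_measure : set (borel T) -> \bar R := riesz_outer.

Let riesz0 : riesz_measure set0 = 0%E. Proof. exact: outer0. Qed.

Let riesz_ge0 (X : set (borel T)) : (0 <= riesz_measure X)%E.
Proof. exact: outer_ge0. Qed.

Let riesz_sigma_additive : semi_sigma_additive riesz_measure.
Proof.
move=> F mF tF mUF.
apply: (@caratheodory_measure_sigma_additive R T riesz_outer) => //.
  by move=> i; exact: borel_caratheodory.
exact: borel_caratheodory.
Qed.

HB.instance Definition _ := isMeasure.Build _ (borel T) R riesz_measure
  riesz0 riesz_ge0 riesz_sigma_additive.

Let riesz_setT : riesz_measure setT = 1%E.
Proof. by congr EFin; exact: outer_setT. Qed.

HB.instance Definition _ :=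
  Measure_isProbability.Build _ (borel T) R riesz_measure riesz_setT.

Let mu : probability (borel T) R := riesz_measure.

(** The set where [d <= g] contains all points with [0 < f] and is covered by
    the constant sequence [g / d], at cost [L g / d]. *)
Let integral_slice (d : R) f g : 0 < d -> continuous f -> continuous g ->
  (forall x, 0 <= f x <= d) -> (forall x, 0 <= g x) ->
  (forall x, 0 < f x -> d <= g x) ->
  \int[mu]_x f x <= L g.
Proof.
move=> d0 cf cg fd g0 fg; pose K := [set x | d <= g x].
have mK : measurable (K : set (borel T)).
  rewrite (_ : K = ~` [set x | g x < d]).
    apply: measurableC; apply: open_borel.
    rewrite (_ : mkset _ = g @^-1` `]-oo, d[%classic).
      by move/continuousP : cg; apply; exact: interval_open.
    by apply/seteqP; split=> x /=; rewrite in_itv.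
  by apply/seteqP; split=> x; rewrite /K/= leNgt => /negP.
apply: (@le_trans _ _ (\int[mu]_x (d * \1_K x))).
  apply: le_Rintegral => //; [exact: continuous_integrable|exact: indicZ_integrable|].
  move=> x _; have /andP[f0 fd'] := fd x.
  have [fx|] := ltP 0 (f x); first by rewrite indicE mem_set ?mulr1//; exact: fg.
  by move=> fx; rewrite (le_trans fx)// mulr_ge0// ltW.
rewrite integral_indicZ//; last exact: ltW.
rewrite mulrC -ler_pdivlMr//; apply: outer_le.
exists (fun _ x => d^-1 * g x).
have cdg : continuous (fun x => d^-1 * g x) by exact: fun_continuousZ.
split=> //.
- by move=> _ x; rewrite mulr_ge0// invr_ge0 ltW.
- by move=> _; rewrite (meanZ meanL)// mulrC.
- by move=> x Kx; exists 0%N; rewrite mulrC ler_pdivlMr// mul1r.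
Qed.

(** Cut [f] into horizontal slices of height [d]. Where a slice is positive the
    slice below is full, so [integral_slice] bounds the integral of each slice
    by [L] of the slice below it; only the bottom slice, of integral at most
    [d], remains. *)
Let integral_le_mean_ge0 f : continuous f -> (forall x, 0 <= f x) ->
  \int[mu]_x f x <= L f.
Proof.
move=> cf f0; apply/ler_addgt0Pr => d d0.
(* [trunc n.+1 - trunc n] is the slice at height [n * d] *)
pose trunc n x := Num.min (n%:R * d) (f x).
have ct n : continuous (trunc n) by exact: fun_continuous_min.
have truncS n x : 0 <= trunc n.+1 x - trunc n x <= d.
  rewrite /trunc -(natr1 n) mulrDl mul1r.
  have [a|a] := leP (f x) (n%:R * d); have [b|b] := leP (f x) (n%:R * d + d);
   apply/andP; split; lra.
have main n : \int[mu]_x trunc n.+1 x - \int[mu]_x trunc 1%N x <= L (trunc n).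
  elim: n => [|n IHn].
    rewrite subrr; apply: (mean_ge0 meanL) => // x.
    by rewrite /trunc mul0r le_min f0 lexx.
  have : \int[mu]_x (trunc n.+2 x - trunc n.+1 x) <=
      L (fun x => trunc n.+1 x - trunc n x).
    apply: (@integral_slice d) => //.
    - exact: fun_continuousB.
    - exact: fun_continuousB.
    - by move=> x; have /andP[] := truncS n x.
    - move=> x; rewrite /trunc -(natr1 n.+1) -(natr1 n) !mulrDl !mul1r.
      have [a|a] := leP (f x) (n%:R * d + d);
      have [b|b] := leP (f x) (n%:R * d); have [e|e] := leP (f x) (n%:R * d + d + d); lra.
  rewrite integralB_continuous// meanB//; lra.
have [C HC] := continuous_bounded cf.
pose N := (Num.truncn (C / d)).+1.
have fN n x : (N <= n)%N -> trunc n x = f x.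
  move=> Nn; rewrite /trunc min_r// (le_trans (ler_norm _))// (le_trans (HC x))//.
  rewrite -ler_pdivrMr// (@le_trans _ _ N%:R) ?ler_nat//.
  exact/ltW/truncnS_gt.
have := main N; rewrite (_ : trunc N.+1 = f); last by apply/funext => x; exact: fN.
rewrite (_ : trunc N = f); last by apply/funext => x; exact: fN.
have : \int[mu]_x trunc 1%N x <= d.
  rewrite -[leRHS](integral_cst_probability mu); apply: le_integral_continuous => //.
    exact: cst_continuous.
  by move=> x; rewrite /trunc mul1r ge_min lexx.
lra.
Qed.

Let integral_le_mean f : continuous f -> \int[mu]_x f x <= L f.
Proof.
move=> cf; have [C HC] := continuous_bounded cf.
have cC : continuous (fun x : T => C) by exact: cst_continuous.
have : \int[mu]_x (f x + C) <= L (fun x => f x + C).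
  apply: integral_le_mean_ge0; first exact: fun_continuousD.
  by move=> x; have := HC x; rewrite ler_norml => /andP[]; lra.
rewrite integralD_continuous// (meanD meanL)//.
by rewrite integral_cst_probability mean_cst lerD2r.
Qed.

Theorem riesz_representation :
  exists mu : probability (borel T) R, forall f, continuous f -> L f = \int[mu]_x f x.
Proof.
exists mu => f cf; apply/eqP; rewrite eq_le integral_le_mean// andbT.
have cN : continuous (fun x => -1 * f x) by exact: fun_continuousZ.
have := integral_le_mean cN.
by rewrite integralZ_continuous// (meanZ meanL)// !mulN1r lerN2.
Qed.

End riesz.

(** * The sequence space and invariant measures *)

(* [shift] otherwise denotes translation in a normed module *)
Local Notation shift := Defs.shift.

Section seqspace_topology.
Context {R : realType} {M : compactMetricType R}.
Implicit Types x y : seqspace M.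

(** The self-similarity of the metric; the contraction and continuity properties
    of [scons] and [shift] all follow from it. *)
Lemma seqdist_shift x y :
  seqdist x y = (mdist (x 0%N) (y 0%N) + seqdist (shift x) (shift y)) / 2.
Proof.
have step n : series (seqdist_term x y) n.+1 =
    (mdist (x 0%N) (y 0%N) + series (seqdist_term (shift x) (shift y)) n) / 2.
  rewrite /series/= big_nat_recl// mulrDl mulr_suml /seqdist_term expr1 mulrC.
  congr (_ + _); apply: eq_bigr => i _.
  by rewrite [2 ^+ i.+2]exprS invfM -!mulrA mulrC -!mulrA.
rewrite /seqdist; apply/cvg_lim => //; rewrite -cvg_shiftS.
under eq_fun do rewrite step.
apply: cvgMl; apply: cvgD; first exact: cvg_cst.
exact: is_cvg_seqdist.
Qed.

Lemma seqdist_le_prefix (C d : R) n x y :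
  (forall a b : M, mdist a b <= C) -> 0 <= d ->
  (forall i, (i < n)%N -> mdist (x i) (y i) <= d) ->
  seqdist x y <= d + C / 2 ^+ n.
Proof.
move=> HC d0; elim: n x y => [|n IHn] x y Hd.
  rewrite expr0 divr1; apply: (@le_trans _ _ C); last by rewrite lerDr.
  apply: limr_le; first exact: is_cvg_seqdist.
  apply: nearW => k.
  apply: (@le_trans _ _ (\sum_(0 <= i < k) (C * (2 ^+ i.+1)^-1))).
    rewrite /series/=; apply: ler_sum => i _.
    by rewrite /seqdist_term mulrC ler_wpM2r// invr_ge0 exprn_ge0.
  have C0 : 0 <= C by exact: le_trans (mdist_ge0 _ _) (HC point point).
  suff -> : \sum_(0 <= i < k) (C * (2 ^+ i.+1)^-1) = C - C / 2 ^+ k.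
    by rewrite lerBlDr lerDl divr_ge0// exprn_ge0.
  elim: k => [|k IHk]; first by rewrite big_geq// expr0 divr1 subrr.
  by rewrite big_nat_recr//= IHk exprS; field; rewrite expf_neq0.
have ih : seqdist (shift x) (shift y) <= d + C / 2 ^+ n.
  by apply: IHn => i ni; exact: (Hd i.+1).
have h0 := Hd 0%N isT.
rewrite seqdist_shift exprS invfM.
by move: ih h0; set q := C / 2 ^+ n; rewrite mulrCA -/q; lra.
Qed.

(** Neighbourhoods for [seqdist] are neighbourhoods for the product topology,
    because the tail of the series is uniformly small; so Tychonoff's theorem
    applies. *)
Lemma seqspace_compact : compact [set: seqspace M].
Proof.
move=> F PF _.
have [a [_ Fa]] := @tychonoff nat (fun=> M) (fun=> setT) (fun=> compact_space) F PF
  (filterS (fun _ _ _ => I) filterT).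
exists a; split => // X B FX /(metricType_numDomainType.nbhs_mdistP)[e /= e0 HB].
apply: Fa => //.
have [C HC] := mdist_bounded M.
have [n Cn] : exists n, C / 2 ^+ n < e / 2.
  have := @cvg_geometric R C 2^-1.
  rewrite ger0_norm ?invr_ge0// invf_lt1// ltr1n => /(_ isT).
  move=> /cvgrPdist_lt/(_ (e / 2) ltac:(by rewrite divr_gt0))[n _ /(_ n (leqnn n))].
  rewrite sub0r normrN /geometric/= exprVn => H.
  by exists n; exact: le_lt_trans (ler_norm _) H.
have : nbhs (a : prod_topology (fun _ : nat => M))
    [set b : nat -> M | forall i : 'I_n, ball (a i) (e / 2) (b i)].
  apply: (@filter_forall _ 'I_n (fun i (b : nat -> M) => ball (a i) (e / 2) (b i))
    _ (nbhs_filter (a : prod_topology (fun _ : nat => M)))) => i.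
  apply: (@proj_continuous nat (fun=> M) i a).
  by apply: nbhsx_ballx; rewrite divr_gt0.
apply: (@filterS _ _ (nbhs_filter (a : prod_topology (fun _ : nat => M)))) => b Hb.
apply: HB => /=.
apply: le_lt_trans (_ : e / 2 + C / 2 ^+ n < e); last by lra.
apply: seqdist_le_prefix => //; first by rewrite divr_ge0// ltW.
by move=> i ni; have := Hb (Ordinal ni); rewrite ballEmdist/= => /ltW.
Qed.

HB.instance Definition _ := isCompactSpace.Build (seqspace M) seqspace_compact.

Lemma mdist_cons (a : M) x y : mdist (scons a x) (scons a y) = mdist x y / 2.
Proof. by rewrite -[LHS]/(seqdist _ _) seqdist_shift mdistxx add0r. Qed.

Lemma mdist_cons_head (a b : M) x : mdist (scons a x) (scons b x) = mdist a b / 2.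
Proof.
by rewrite -[LHS]/(seqdist _ _) seqdist_shift -[seqdist _ _]/(mdist x x) mdistxx addr0.
Qed.

Lemma scons_shift x : scons (x 0%N) (shift x) = x.
Proof. by apply/funext; case. Qed.

Lemma shift_continuous : continuous (@Defs.shift R M).
Proof.
apply: (@lipschitz_continuous _ _ _ 2) => // x y.
rewrite -[X in _ <= _ * X]/(seqdist _ _) seqdist_shift mulrC divfK//.
by rewrite lerDr mdist_ge0.
Qed.

Lemma scons_continuous_head x : continuous (fun a : M => scons a x).
Proof.
apply: (@lipschitz_continuous _ _ _ 2^-1); first by rewrite invr_gt0.
by move=> a b; rewrite mdist_cons_head mulrC.
Qed.

End seqspace_topology.

Section invariance.
Context {R : realType} {M : compactMetricType R}.
Implicit Types (phi : seqspace M -> R) (rho : probability (borel (seqspace M)) R).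

Lemma continuous_comp_shift phi : continuous phi -> continuous (fun x => phi (shift x)).
Proof.
move=> cphi x; apply: continuous_comp; last exact: cphi.
exact: shift_continuous.
Qed.

(** The shift between the measurable spaces rather than the metric ones, so that
    it can be used as a random variable. *)
Definition borel_shift : borel (seqspace M) -> borel (seqspace M) := @Defs.shift R M.

Lemma borel_shift_measurable : measurable_fun [set: borel (seqspace M)] borel_shift.
Proof.
apply: (@measurability _ _ (borel (seqspace M)) (borel (seqspace M)) setT
  borel_shift (@open (seqspace M))) => // _ [U oU <-]; rewrite setTI.
apply: open_borel.
exact: (proj1 (continuousP (@Defs.shift R M)) shift_continuous U oU).
Qed.

HB.instance Definition _ := isMeasurableFun.Build _ _
  (borel (seqspace M)) (borel (seqspace M)) borel_shift borel_shift_measurable.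

Lemma integral_distribution_shift rho phi : continuous phi ->
  \int[distribution rho borel_shift]_x phi x = \int[rho]_x phi (shift x).
Proof.
move=> cphi; congr fine; rewrite integral_pushforward//.
- by apply/measurable_EFinP; exact: continuous_borel.
- rewrite preimage_setT.
  exact: (continuous_integrable rho (continuous_comp_shift cphi)).
Qed.

(** Invariance tested on continuous functions: the form that a fixed point of
    the dual transfer operator provides, and that passes to weak limits. *)
Definition integral_invariant rho : Prop := forall phi, continuous phi ->
  \int[rho]_x phi (shift x) = \int[rho]_x phi x.

Lemma shift_invariantP rho : shift_invariant rho <-> integral_invariant rho.
Proof.
split=> [rho_inv phi cphi|rho_inv].
  rewrite -integral_distribution_shift//; congr fine.
  by apply: eq_measure_integral => X mX _; exact: rho_inv.
move=> X mX.
apply: (eq_borel_of_continuous (mu1 := distribution rho borel_shift)) => //.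
by move=> phi cphi; rewrite integral_distribution_shift// rho_inv.
Qed.

End invariance.

(** * Hoelder functions *)

Section powR.
Context {R : realType} (alpha : R) (alpha0 : 0 < alpha).

Lemma powR_surj (e : R) : 0 < e -> exists2 r, 0 < r & r `^ alpha = e.
Proof.
move=> e0; exists (e `^ alpha^-1); first exact: powR_gt0.
by rewrite -powRrM mulVf ?gt_eqF// powRr1// ltW.
Qed.

Lemma powR2_gt1 : 1 < 2 `^ alpha.
Proof.
rewrite -[ltLHS](_ : 1 `^ alpha = 1); last by rewrite powR1.
by apply: (gt0_ltr_powR alpha0); rewrite ?nnegrE ?ltr1n.
Qed.

Lemma powR_half (d : R) : 0 <= d -> (d / 2) `^ alpha = d `^ alpha / 2 `^ alpha.
Proof.
move=> d0; rewrite -[d in RHS](@divfK _ 2)// [in RHS]powRM ?divr_ge0//.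
by rewrite mulfK// gt_eqF// powR_gt0.
Qed.

Lemma le_powR (x y : R) : 0 <= x -> x <= y -> x `^ alpha <= y `^ alpha.
Proof.
move=> x0 xy; apply: (ge0_ler_powR (ltW alpha0)) => //; rewrite nnegrE//.
exact: le_trans xy.
Qed.

End powR.

Section holder.
Context {R : realType} {M : compactMetricType R} (alpha : R) (alpha0 : 0 < alpha).
Implicit Types phi psi : seqspace M -> R.

Lemma holder_continuous phi : holder alpha phi -> continuous phi.
Proof.
move=> [C HC]; apply: continuous_of_modulus => x e e0.
have C0 : 0 < `|C| + 1 by rewrite ltr_wpDl.
have [r r0 re] := powR_surj alpha0 (divr_gt0 e0 C0).
exists r => // y xy; rewrite (le_lt_trans (HC x y))//.
have H : mdist x y `^ alpha < r `^ alpha.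
  by apply: (gt0_ltr_powR alpha0); rewrite ?nnegrE ?mdist_ge0// ltW.
have -> : e = (`|C| + 1) * r `^ alpha by rewrite re mulrC divfK// gt_eqF.
have P0 := powR_ge0 (mdist x y) alpha.
apply: (@le_lt_trans _ _ ((`|C| + 1) * mdist x y `^ alpha)).
  by rewrite ler_wpM2r// (le_trans (ler_norm C))// lerDl.
by rewrite ltr_pM2l.
Qed.

(** By symmetry of the distance this is the usual two-sided condition. For the
    logarithm of a positive function it bounds the ratios of its values. *)
Definition one_sided_holder (D : R) phi : Prop :=
  forall x y, phi x <= phi y + D * mdist x y `^ alpha.

Lemma holder_one_sided phi : holder alpha phi ->
  exists2 C, 0 <= C & one_sided_holder C phi.
Proof.
move=> [C HC]; exists `|C| => // x y.
rewrite -lerBlDl (le_trans (ler_norm _))// (le_trans (HC x y))//.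
by rewrite ler_wpM2r ?powR_ge0// ler_norm.
Qed.

Lemma ln_holder psi : holder alpha psi -> (forall x, 0 < psi x) ->
  exists2 D, 0 <= D & one_sided_holder D (fun x => ln (psi x)).
Proof.
move=> hpsi psi0.
have [c c0 Hc] := continuous_gt0_bounded_below (holder_continuous hpsi) psi0.
have [C C0 HC] := holder_one_sided hpsi.
exists (C / c) => [|x y]; first by rewrite divr_ge0// ltW.
have -> : psi x = psi y * (1 + (psi x - psi y) / psi y).
  by field; rewrite gt_eqF.
have t1 : -1 < (psi x - psi y) / psi y.
  by rewrite mulrBl divff ?gt_eqF// ltrBrDr addrC subrr divr_gt0.
rewrite lnM ?posrE//; last by rewrite -ltrBlDl sub0r.
rewrite lerD2l (le_trans (le_ln1Dx t1))// ler_pdivrMr//.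
rewrite (@le_trans _ _ (C * mdist x y `^ alpha))//.
  by have := HC x y; rewrite addrC -lerBlDr.
rewrite (_ : C / c * _ * _ = C * mdist x y `^ alpha * (psi y / c)); last by ring.
by rewrite ler_peMr ?mulr_ge0 ?powR_ge0// ler_pdivlMr// mul1r.
Qed.

End holder.

(** * Eigenfunctions and the normalized potential *)

Section eigen.
Context {R : realType} {M : compactMetricType R}.
Context (alpha : R) (nu : probability (borel M) R) (B : seqspace M -> R) (C : R).
Context (alpha0 : 0 < alpha) (C0 : 0 <= C) (cB : continuous B)
  (hB : one_sided_holder alpha C B).
Context (lambda : R) (psi : seqspace M -> R)
  (eig : eigenpair alpha nu B lambda psi).

Let lambda0 : 0 < lambda. Proof. by case: eig. Qed.
Let psi0 x : 0 < psi x. Proof. by case: eig. Qed.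
Let cpsi : continuous psi. Proof. by case: eig => _ /(holder_continuous alpha0). Qed.
Let psiE x : \int[nu]_a (expR (B (scons a x)) * psi (scons a x)) = lambda * psi x.
Proof. by case: eig => _ _ _; exact. Qed.

Let continuous_expR_fun (T : topologicalType) (f : T -> R) :
  continuous f -> continuous (fun x => expR (f x)).
Proof. by move=> cf x; apply: continuous_comp; [exact: cf|exact: continuous_expR]. Qed.

Let continuous_ln_psi : continuous (fun x => ln (psi x)).
Proof. by move=> x; apply: continuous_comp; [exact: cpsi|exact: continuous_ln]. Qed.

Let continuous_head (f : seqspace M -> R) x :
  continuous f -> continuous (fun a : M => f (scons a x)).
Proof.
move=> cf a; apply: continuous_comp; last exact: cf.
exact: scons_continuous_head.
Qed.

Let continuous_eigen_integrand x :
  continuous (fun a : M => expR (B (scons a x)) * psi (scons a x)).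
Proof.
by apply: fun_continuousM; [exact/continuous_expR_fun/continuous_head|
                            exact: continuous_head].
Qed.

(** Comparing the eigenfunction equations at [x] and [y] under the integral,
    where the arguments [scons a x] and [scons a y] are twice as close. *)
Let eigen_ln_holder_step D : 0 <= D -> one_sided_holder alpha D (fun x => ln (psi x)) ->
  one_sided_holder alpha ((C + D) / 2 `^ alpha) (fun x => ln (psi x)).
Proof.
move=> D0 HD x y; set t := _ * _ `^ alpha.
have psixy : psi x <= expR t * psi y.
  rewrite -(ler_pM2l lambda0) -psiE mulrCA -psiE -integralZ_continuous; last first.
    exact: continuous_eigen_integrand.
  apply: le_integral_continuous.
  - exact: continuous_eigen_integrand.
  - exact/fun_continuousZ/continuous_eigen_integrand.
  move=> a; rewrite -[psi (scons a x)]lnK ?posrE// -[psi (scons a y)]lnK ?posrE//.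
  rewrite -!expRD ler_expR.
  have := hB (scons a x) (scons a y); have := HD (scons a x) (scons a y).
  rewrite mdist_cons powR_half ?mdist_ge0//.
  have -> : t = C * (mdist x y `^ alpha / 2 `^ alpha) +
      D * (mdist x y `^ alpha / 2 `^ alpha).
    by rewrite -mulrDl /t mulrA mulrAC.
  lra.
rewrite -[leRHS]addrC -[t]expRK -lnM ?posrE ?expR_gt0// ler_ln ?posrE ?psi0//.
by rewrite mulr_gt0 ?expR_gt0.
Qed.

(** [C / (2 `^ alpha - 1)] is the fixed point of [D |-> (C + D) / 2 `^ alpha].
    It is reached in the limit from the finite but uncontrolled Hoelder constant
    that [psi] has by assumption. *)
Lemma eigen_ln_holder :
  one_sided_holder alpha (C / (2 `^ alpha - 1)) (fun x => ln (psi x)).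
Proof.
have [_ hpsi _ _] := eig.
have [D D0 HD] := ln_holder alpha0 hpsi psi0.
have q1 := powR2_gt1 alpha0; set q := 2 `^ alpha in q1 *.
have q0 : 0 < q by exact: lt_trans q1.
pose K := C / (q - 1); have K0 : 0 <= K by rewrite divr_ge0// subr_ge0 ltW.
have iter n : one_sided_holder alpha (K + D / q ^+ n) (fun x => ln (psi x)).
  elim: n => [|n IHn].
    move=> x y; rewrite expr0 divr1 (le_trans (HD x y))// lerD2l.
    by rewrite ler_wpM2r ?powR_ge0// lerDr.
  have -> : K + D / q ^+ n.+1 = (C + (K + D / q ^+ n)) / q.
    by rewrite /K exprS; field; rewrite expf_neq0 ?gt_eqF ?subr_gt0.
  apply: eigen_ln_holder_step IHn.
  by rewrite addr_ge0// divr_ge0// exprn_ge0// ltW.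
move=> x y; rewrite -/K; set m := mdist x y `^ alpha.
suff : ln (psi x) - ln (psi y) - K * m <= 0 by lra.
have cv : geometric (D * m) q^-1 @ \oo --> (0 : R).
  by apply: cvg_geometric; rewrite ger0_norm ?invr_ge0 ?(ltW q0)// invf_lt1.
apply: (cvgr_to_ge cv); apply: nearW => n.
by have := iter n x y; rewrite -/m /geometric/= exprVn mulrDl mulrAC; lra.
Qed.

Let g := normalization B lambda psi.

Lemma normalization_continuous : continuous g.
Proof.
apply: fun_continuousB; last exact: cst_continuous.
apply: fun_continuousB; last exact: (continuous_comp_shift continuous_ln_psi).
exact: fun_continuousD.
Qed.

Let continuous_expg x : continuous (fun a : M => expR (g (scons a x))).
Proof. exact/continuous_expR_fun/continuous_head/normalization_continuous. Qed.

(** The eigenfunction equation, divided by its right-hand side. *)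
Lemma normalization_mass1 x : \int[nu]_a expR (g (scons a x)) = 1.
Proof.
have -> : (fun a => expR (g (scons a x))) =
    (fun a => (lambda * psi x)^-1 * (expR (B (scons a x)) * psi (scons a x))).
  apply/funext => a; rewrite /g /normalization.
  rewrite -[shift (scons a x)]/x !(expRD, expRN) !lnK ?posrE// invfM; ring.
rewrite integralZ_continuous; last exact: continuous_eigen_integrand.
by rewrite psiE mulVf// gt_eqF// mulr_gt0.
Qed.

(** The Hoelder constant of the normalized potential in its first coordinate: the
    term [ln (psi (shift x))] does not depend on it. *)
Let L := C + C / (2 `^ alpha - 1).

Let L0 : 0 <= L.
Proof. by rewrite addr_ge0// divr_ge0// subr_ge0 ltW// powR2_gt1. Qed.

Lemma normalization_change_head a x :
  g x <= g (scons a (shift x)) + L * mdist (x 0%N) a `^ alpha.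
Proof.
rewrite -{1}[x]scons_shift /g /normalization; set y := shift x.
rewrite -[shift (scons a y)]/y -[shift (scons _ y)]/y.
have := hB (scons (x 0%N) y) (scons a y).
have := eigen_ln_holder (scons (x 0%N) y) (scons a y).
rewrite mdist_cons_head.
have H : (mdist (x 0%N) a / 2) `^ alpha <= mdist (x 0%N) a `^ alpha.
  rewrite le_powR ?divr_ge0 ?mdist_ge0// ler_pdivrMr// ler_peMr ?mdist_ge0//.
  by rewrite ler1n.
have := ler_wpM2l L0 H; rewrite [L * (_ / 2) `^ _]mulrDl; lra.
Qed.

(** By [normalization_change_head], [exp g] is at least
    [exp (g x - L * r `^ alpha)] when the head of [x] moves in a ball of radius
    [r], while its integral over all heads is 1. *)
Lemma normalization_le r c x : 0 < r -> 0 < c ->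
  (forall a, c <= fine (nu (ball a r)^°)) ->
  g x <= L * r `^ alpha - ln c.
Proof.
move=> r0 c0 Hc; set b := ball (x 0%N) r.
have : expR (g x - L * r `^ alpha) * fine (nu b^°) <= 1.
  rewrite -(normalization_mass1 (shift x)); apply: markov_continuous => //.
  - by apply: open_borel; exact: open_interior.
  - move=> a /interior_subset; rewrite /b ballEmdist/= => xa.
    rewrite ler_expR lerBlDr (le_trans (normalization_change_head a x))//.
    by rewrite lerD2l ler_wpM2l// le_powR ?mdist_ge0// ltW.
move=> /(le_trans (ler_wpM2l (expR_ge0 _) (Hc _))).
rewrite -[c in X in X -> _]lnK ?posrE// -expRD -[leRHS]expR0 ler_expR; lra.
Qed.

(** The normalized transfer operator is a left inverse of composition with the
    shift. *)
Lemma gibbs_integral_invariant mu : dual_transfer nu g mu mu -> integral_invariant mu.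
Proof.
move=> dual phi cphi; rewrite dual; last exact: continuous_comp_shift.
congr (Rintegral mu setT _); apply/funext => x; rewrite /transfer.
under eq_Rintegral do rewrite -[shift (scons _ x)]/x.
rewrite RintegralZr//; last exact: continuous_integrable.
by rewrite normalization_mass1 mul1r.
Qed.

(** The entropy of the Gibbs measure relative to [nu] is [- \int[mu]_x g x]; it is
    nonpositive as [t * expR t >= expR t - 1] and both [expR g] and 1 have
    [nu]-integral 1 over the head. *)
Lemma integral_normalization_ge0 mu : dual_transfer nu g mu mu -> 0 <= \int[mu]_x g x.
Proof.
move=> dual; rewrite dual; last exact: normalization_continuous.
apply: Rintegral_ge0 => x _; rewrite /transfer.
have cg1 : continuous (fun a : M => expR (g (scons a x)) - 1).
  by apply: fun_continuousB => //; exact: cst_continuous.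
have -> : 0 = \int[nu]_a (expR (g (scons a x)) - 1).
  rewrite integralB_continuous//; last exact: cst_continuous.
  by rewrite normalization_mass1 integral_cst_probability subrr.
apply: le_integral_continuous => //.
  by apply: fun_continuousM => //; exact/continuous_head/normalization_continuous.
move=> a; set t := g _; have := expR_ge1Dx (- t).
rewrite expRN -(ler_pM2l (expR_gt0 t)) divff ?gt_eqF ?expR_gt0//; lra.
Qed.

(** Against an invariant measure the coboundary [ln psi - ln (psi o shift)]
    vanishes. *)
Lemma integral_normalization rho : integral_invariant rho ->
  \int[rho]_x g x = \int[rho]_x B x - ln lambda.
Proof.
move=> inv; have cl := continuous_ln_psi; have cls := continuous_comp_shift cl.
rewrite integralB_continuous; [|..|exact: cst_continuous]; last first.
  by apply: fun_continuousB => //; exact: fun_continuousD.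
rewrite integral_cst_probability integralB_continuous//; last exact: fun_continuousD.
by rewrite integralD_continuous// (inv _ cl) addrK.
Qed.

End eigen.

(** * Weak compactness of the set of probabilities *)

Section weak_compactness.
Context {R : realType} {T : compactMetricType R}.

(** If some neighbourhood [B] of [l] fails, then [F] together with the
    complement of the preimage of [B] extends to an ultrafilter. *)
Lemma cvg_ultra {I : Type} {V : topologicalType} (F : set_system I) {FF : Filter F}
    (h : I -> V) (l : V) :
  (forall G, UltraFilter G -> F `<=` G -> h @ G --> l) -> h @ F --> l.
Proof.
move=> H B lB; apply: contrapT => nFB.
have PW : ProperFilter (within (~` (h @^-1` B)) F).
  split; last exact: within_filter.
  rewrite /within/= => W0; apply: nFB; move: W0; apply: filterS => i.
  exact: contrapT.
have [G [GU WG]] := ultraFilterLemma PW.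
have GC : G (~` (h @^-1` B)) by apply: WG; exact: withinT.
have GB : G (h @^-1` B).
  by apply: (H G GU _ B lB) => X FX; apply: WG; apply: filterS FX => i Xi _.
have [i [iB niB]] := @filter_ex _ G _ _ (filterI GB GC).
exact: niB.
Qed.

Lemma bounded_ultra_cvg {I : Type} (G : set_system I) (h : I -> R) (C : R) :
  UltraFilter G -> (forall i, `|h i| <= C) -> exists l : R, h i @[i --> G] --> l.
Proof.
move=> GU hC.
have [] := @segment_compact R (- C) C (h @ G) _.
  by apply: (@filterE _ G) => i /=; rewrite in_itv/= -ler_norml.
move=> l [_ cl]; exists l => B lB.
have [//|GnB] := in_ultra_setVsetC (h @^-1` B) GU.
by have [y [/= nBy By]] := cl (~` B) B GnB lB.
Qed.

(** Limits of integrals along [G] exist because they are bounded, and they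
    inherit the properties required by [riesz_representation]. *)
Lemma probability_weak_ultralimit {I : Type} (G : set_system I)
    (mu_ : I -> probability (borel T) R) : UltraFilter G ->
  exists mu : probability (borel T) R, forall f : T -> R, continuous f ->
    \int[mu_ i]_x f x @[i --> G] --> \int[mu]_x f x.
Proof.
move=> GU.
pose L (f : T -> R) : R := lim (\int[mu_ i]_x f x @[i --> G]).
have Lcvg f : continuous f -> \int[mu_ i]_x f x @[i --> G] --> L f.
  move=> cf; have [C HC] := continuous_bounded cf.
  apply/cvg_ex; apply: (@bounded_ultra_cvg _ _ _ C) => // i.
  rewrite -(integral_cst_probability (mu_ i) C).
  apply: le_trans (le_normr_Rintegral _ _) _ => //; first exact: continuous_integrable.
  apply: le_integral_continuous => //; last exact: cst_continuous.
  by move=> x; apply: continuous_comp; [exact: cf|exact: norm_continuous].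
have L_mean : mean L.
  split.
  - move=> f g cf cg; apply/cvg_lim => //.
    under eq_fun do rewrite integralD_continuous//.
    by apply: cvgD; exact: Lcvg.
  - move=> c f cf; apply/cvg_lim => //.
    under eq_fun do rewrite integralZ_continuous//.
    by apply: cvgMr; exact: Lcvg.
  - move=> f cf f0; apply: (cvgr_to_ge (Lcvg _ cf)); apply: nearW => i.
    by apply: Rintegral_ge0.
  - apply/cvg_lim => //; under eq_fun do rewrite integral_cst_probability.
    exact: cvg_cst.
have [mu Lmu] := riesz_representation L_mean.
by exists mu => f cf; rewrite -Lmu//; exact: Lcvg.
Qed.

End weak_compactness.

(** * The zero temperature limit *)

Section full_support.
Context {R : realType} {M : compactMetricType R}.

(** By compactness: if [b] is within [r / 2] of [a], the ball of radius [r] at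
    [b] contains the ball of radius [r / 2] at [a], which is charged. Interiors
    are taken to have open, hence Borel, sets. *)
Lemma ball_mass_bounded_below (nu : probability (borel M) R) (r : R) :
  measure_support nu = [set: M] -> 0 < r ->
  exists2 c, 0 < c & forall a : M, c <= fine (nu (ball a r)^°).
Proof.
move=> nuT r0; have r20 : 0 < r / 2 by rewrite divr_gt0.
have : \forall c \near 0^'+, [set: M] `<=` [set a | c <= fine (nu (ball a r)^°)].
  have /compact_near_coveringP := @compact_space _ M; apply=> a _.
  have nu_gt0 : 0 < fine (nu (ball a (r / 2))^°).
    rewrite fine_gt0//; apply/andP; split.
      have : measure_support nu a by rewrite nuT.
      apply; first exact: open_interior.
      exact: nbhsx_ballx.
    rewrite -ge0_fin_numE//; apply: fin_num_measure; apply: open_borel.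
    exact: open_interior.
  exists (ball a (r / 2), [set c | c <= fine (nu (ball a (r / 2))^°)]) => /=.
    by split; [exact: nbhsx_ballx|exact: nbhs_right_le].
  move=> [b c]/= [ab ca]; apply: le_trans ca _.
  apply: fine_le.
  - by apply: fin_num_measure; apply: open_borel; exact: open_interior.
  - by apply: fin_num_measure; apply: open_borel; exact: open_interior.
  - apply: le_measure; rewrite ?inE; [by apply: open_borel; exact: open_interior..|].
    apply: interiorS => y ay; rewrite [r]splitr; apply: ball_triangle ay.
    exact: ball_sym.
move=> H.
have [c [Hc c0]] := filter_ex (filterI H (nbhs_right_gt (0 : R))).
by exists c => // a; exact: Hc.
Qed.

End full_support.

Section zero_temperature.
Context {R : realType} {M : compactMetricType R}.
Context (alpha : R) (nu : probability (borel M) R) (A : seqspace M -> R).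
Context (alpha0 : 0 < alpha) (nuT : measure_support nu = [set: M])
  (hA : holder alpha A).
Implicit Types mu rho : probability (borel (seqspace M)) R.

Let cA : continuous A. Proof. exact: holder_continuous hA. Qed.

Let cZA (b : R) : continuous (fun x => b * A x). Proof. exact: fun_continuousZ. Qed.

Lemma gibbs_invariant (b : R) mu : gibbs alpha nu (fun x => b * A x) mu ->
  integral_invariant mu.
Proof.
move=> [l [psi [eig dual]]].
exact: (gibbs_integral_invariant alpha0 (@cZA b) eig dual).
Qed.

(** Comparing [integral_normalization] for [mu] and for [rho], the eigenvalue
    cancels: its bounds come from [integral_normalization_ge0] and
    [normalization_le]. The potential [b * A] has Hoelder constant [b * C], so
    the error is [L * r `^ alpha - ln c / b], uniformly in [rho]. *)
Lemma gibbs_almost_maximizing (e : R) : 0 < e ->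
  \forall b \near +oo, forall mu rho, gibbs alpha nu (fun x => b * A x) mu ->
    integral_invariant rho -> \int[rho]_x A x <= \int[mu]_x A x + e.
Proof.
move=> e0; have [C C0 HC] := holder_one_sided hA.
pose L := C + C / (2 `^ alpha - 1).
have L0 : 0 <= L by rewrite addr_ge0// divr_ge0// subr_ge0 ltW// powR2_gt1.
have L1 : 0 < 2 * (L + 1) by rewrite mulr_gt0// ltr_wpDl.
(* [L + 1] rather than [L], which vanishes for constant [A] *)
have [r r0 re] := powR_surj alpha0 (divr_gt0 e0 L1).
have Lr : L * r `^ alpha <= e / 2.
  rewrite re (_ : L * _ = L / (L + 1) * (e / 2)); last by field; lra.
  by rewrite ler_piMl ?divr_ge0 ?(ltW e0)// ler_pdivrMr ?ltr_wpDl// mul1r lerDl.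
have [c c0 Hc] := ball_mass_bounded_below nuT r0.
near=> b => mu rho [l [psi [eig dual]]] inv.
have b0 : 0 < b by near: b; exact: nbhs_pinfty_gt.
have hbA : one_sided_holder alpha (b * C) (fun x => b * A x).
  by move=> x y; rewrite -mulrA -mulrDr ler_pM2l.
have bC0 : 0 <= b * C by rewrite mulr_ge0// ltW.
have g_le x := normalization_le alpha0 bC0 (@cZA b) hbA eig x r0 c0 Hc.
have mu_ge := integral_normalization_ge0 alpha0 (@cZA b) eig dual.
rewrite (integral_normalization alpha0 (@cZA b) eig) in mu_ge; last first.
  exact: (gibbs_integral_invariant alpha0 (@cZA b) eig dual).
have := integral_normalization alpha0 (@cZA b) eig inv.
have : \int[rho]_x normalization (fun x => b * A x) l psi x <=
    b * L * r `^ alpha - ln c.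
  rewrite -(integral_cst_probability rho (_ - _)); apply: le_integral_continuous.
  - exact: (normalization_continuous alpha0 (@cZA b) eig).
  - exact: cst_continuous.
  - by move=> x; rewrite /L mulrDr mulrA; exact: g_le.
move=> /[swap] ->; rewrite !integralZ_continuous// in mu_ge *; move=> rho_le.
have bln : - ln c <= b * (e / 2).
  by rewrite -ler_pdivrMr ?divr_gt0//; near: b; exact: nbhs_pinfty_ge.
rewrite -(ler_pM2l b0) mulrDr.
have : b * (L * r `^ alpha) <= b * (e / 2) by rewrite ler_pM2l.
rewrite mulrA => Lr'.
have -> : b * e = b * (e / 2) + b * (e / 2) by field.
lra.
Unshelve. all: by end_near. Qed.

Lemma weak_limit_maximizing (F : set_system R)
    (mu_ : R -> probability (borel (seqspace M)) R) mu : ProperFilter F -> F --> +oo ->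
  (forall b, 0 < b -> gibbs alpha nu (fun x => b * A x) (mu_ b)) ->
  weak_cvg F mu_ mu -> maximizing A mu.
Proof.
move=> PF Foo hmu Fmu.
have F0 : \forall b \near F, 0 < b by apply: Foo; exact: nbhs_pinfty_gt.
have mu_inv : integral_invariant mu.
  move=> phi cphi; have H1 := Fmu _ cphi.
  have H2 := Fmu _ (continuous_comp_shift cphi).
  have /cvg_lim <- // := H2; apply/cvg_lim => //.
  apply: cvg_trans H1; apply: near_eq_cvg.
  by near=> b; rewrite (gibbs_invariant (hmu b _))//; near: b.
have mu_max rho : integral_invariant rho -> \int[rho]_x A x <= \int[mu]_x A x.
  move=> inv; apply/ler_addgt0Pr => e e0; rewrite -lerBlDr.
  apply: (cvgr_to_ge (Fmu _ cA)).
  have H := Foo _ (gibbs_almost_maximizing e0).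
  near=> b; rewrite lerBlDr; near: b.
  apply: filterS2 F0 H => b b0 Hb; apply: Hb => //.
  exact: hmu.
split; first exact/shift_invariantP.
apply/eqP; rewrite eq_le; apply/andP; split.
  apply: ub_le_sup; last by exists mu => //; exact/shift_invariantP.
  by exists (\int[mu]_x A x) => _ [rho /shift_invariantP inv <-]; exact: mu_max.
apply: ge_sup; first by exists (\int[mu]_x A x), mu => //; exact/shift_invariantP.
by move=> _ [rho /shift_invariantP inv <-]; exact: mu_max.
Unshelve. all: by end_near. Qed.

End zero_temperature.

Theorem theorem5 (R : realType) (M : compactMetricType R) (alpha : R)
    (halpha : 0 < alpha <= 1) (nu : probability (borel M) R)
    (hnu : measure_support nu = [set: M])
    (A : seqspace M -> R) (hA : holder alpha A)
    (mu_ : R -> probability (borel (seqspace M)) R)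
    (hmu : forall beta : R, 0 < beta ->
      gibbs alpha nu (fun x => beta * A x) (mu_ beta)) :
  (forall (b : nat -> R) (mu : probability (borel (seqspace M)) R),
     (forall n, 0 < b n) -> b n @[n --> \oo] --> +oo ->
     weak_cvg \oo (fun n => mu_ (b n)) mu ->
     maximizing A mu) /\
  (unique_maximizing A ->
   exists mu : probability (borel (seqspace M)) R, weak_cvg +oo mu_ mu).
Proof.
have /andP[alpha0 _] := halpha.
split=> [b mu _ boo bmu|[mu [_ mu_unique]]].
  (* weak convergence along [b n] is weak convergence along the filter [b @ \oo] *)
  exact: (@weak_limit_maximizing _ _ _ _ _ alpha0 hnu hA (b @ \oo) mu_).
exists mu => phi cphi; apply: cvg_ultra => G GU ooG.
have [mu' Gmu'] := probability_weak_ultralimit mu_ GU.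
have mu'_max := weak_limit_maximizing alpha0 hnu hA
  (@ultra_proper _ _ GU) ooG hmu Gmu'.
suff -> : \int[mu]_x phi x = \int[mu']_x phi x by exact: Gmu'.
congr fine; apply: eq_measure_integral => X mX _.
exact: esym (mu_unique mu' mu'_max X mX).
Qed.
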